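(* Let $G$ be an infinite, finitely generated group with finite symmetric generating set $S$ and edge lengths $l$, and let $(Z_n)_{n\in\mathbb{N}_0}=((\eta_n,X_n))_{n\in\mathbb{N}_0}$ be a lamplighter random walk on $\mathcal{L}=\mathbb{Z}_2\wr G$ as described in the context (transience of the projection $(X_n)_{n\in\mathbb{N}_0}$ onto $G$ is not assumed). Then $$\ell_{\mathrm{supp}}=\lim_{n\to\infty}\frac{|\mathrm{supp}(\eta_n)|}{n}>0$$ if and only if $(X_n)_{n\in\mathbb{N}_0}$ is transient.
   Context: $G$ is an infinite group with identity $e$; $S\subseteq G\setminus\{e\}$ is a finite symmetric set generating $G$ as a semigroup. Each $s\in S$ has a length $l(s)=l(s^{-1})>0$. The metric on $G$ is $d(x,y)=\min\{\sum_{i=1}^n l(s_i) : s_1,\dots,s_n\in S,\ y=xs_1\cdots s_n\}$. $\mathbb{Z}_2=\mathbb{Z}/2\mathbb{Z}$; $\mathcal{N}$ is the set of finitely supported $\eta:G\to\mathbb{Z}_2$; $\mathbf{0}$ is the zero configuration. $\mathcal{L}=\mathbb{Z}_2\wr G$ is $\mathcal{N}\times G$ with product $(\eta_1,x)(\eta_2,y)=(\eta_1\oplus x\eta_2,xy)$, where $(x\eta)(w)=\eta(x^{-1}w)$ and $\oplus$ is componentwise addition mod 2. Lamplighter random walk: $(\mathbf{i}_n)_{n\ge1}$ are i.i.d. $\mathcal{L}$-valued with law $\mu$, $Z_0=(\mathbf{0},e)$, $Z_n=Z_{n-1}\mathbf{i}_n$, $Z_n=(\eta_n,X_n)$. Assumptions: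 $(Z_n)$ is irreducible (every element of $\mathcal{L}$ is reached from every other with positive probability) and transient, and (1) $\langle\mathrm{supp}(\mu)\rangle=\mathcal{L}$; (2) there is $R\ge0$ such that $\mu(\eta,x)>0$ implies $d(e,y)\le R$ for all $y\in\mathrm{supp}(\eta)$; (3) $\sum_{(\eta,x)\in\mathcal{L}}d(e,x)\mu(\eta,x)<\infty$. The limit $\ell_{\mathrm{supp}}=\lim_n|\mathrm{supp}(\eta_n)|/n$ exists almost surely and is constant (Kingman's subadditive ergodic theorem). *)

(* Defs.v *)
From HB Require Import structures.
From mathcomp Require Import all_boot all_order all_algebra finmap.
From mathcomp Require Import all_classical all_reals all_analysis.

Set Implicit Arguments.
Unset Strict Implicit.
Unset Printing Implicit Defensive.
Import Order.TTheory GRing.Theory Num.Theory.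
Import numFieldNormedType.Exports.

Local Open Scope classical_set_scope.
Local Open Scope ring_scope.

Section Generation.
Variable H : groupType.

Definition subsemigroup (B : set H) :=
  forall x y, B x -> B y -> B (x * y)%g.

Definition subgroup (B : set H) :=
  B 1%g /\ forall x y, B x -> B y -> B (x * y^-1)%g.

Definition generates_semigroup (A : set H) :=
  smallest subsemigroup A = [set: H].

Definition generates_group (A : set H) := smallest subgroup A = [set: H].

End Generation.

(* The weighted word metric. For finite [S] and positive [l] the infimum is
   attained whenever [S] generates; the empty word gives [dist S l x x = 0]. *)
Definition dist (R : realType) (G : groupType) (S : {fset G}) (l : G -> R)
    (x y : G) : R :=
  inf [set \sum_(s <- w) l s |
       w in [set w : seq G | {subset w <= S} /\ y = (x * \prod_(s <- w) s)%g]].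

Definition config (G : groupType) := {fsfun G -> 'Z_2 with 0}.

HB.instance Definition _ (G : groupType) := Choice.on (config G).

Section Lamplighter.
Variable G : groupType.
Implicit Types (eta : config G) (x w : G).

Definition config0 : config G := [fsfun].

Definition config_add eta1 eta2 : config G :=
  [fsfun w in (finsupp eta1 `|` finsupp eta2)%fset => eta1 w + eta2 w].

Definition config_shift x eta : config G :=
  [fsfun w in [fset (x * y)%g | y in finsupp eta]%fset => eta (x^-1 * w)%g].

Lemma config0E w : config0 w = 0.
Proof. by rewrite fsfunE. Qed.

Lemma config_addE eta1 eta2 w : config_add eta1 eta2 w = eta1 w + eta2 w.
Proof.
rewrite fsfunE in_fsetU; case: ifPn => //; rewrite negb_or => /andP[w1 w2].
by rewrite !fsfun_dflt // addr0.
Qed.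

Lemma config_shiftE x eta w : config_shift x eta w = eta (x^-1 * w)%g.
Proof.
rewrite fsfunE; case: ifPn => // /imfsetP wN.
rewrite fsfun_dflt //; apply/negP => xw; apply: wN.
by exists (x^-1 * w)%g; rewrite //= mulVKg.
Qed.

Definition lamplighter : Type := config G * G.

HB.instance Definition _ := Choice.on lamplighter.

Definition lamp_one : lamplighter := (config0, 1%g).

Definition lamp_mul (z1 z2 : lamplighter) : lamplighter :=
  (config_add z1.1 (config_shift z1.2 z2.1), (z1.2 * z2.2)%g).

Definition lamp_inv (z : lamplighter) : lamplighter :=
  (config_shift z.2^-1 z.1, z.2^-1)%g.

Lemma lamp_mulA : associative lamp_mul.
Proof.
move=> [e1 x1] [e2 x2] [e3 x3]; congr (_, _); last exact: mulgA.
apply/fsfunP => w; rewrite /= !(config_addE, config_shiftE) addrA.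
by rewrite invgM -mulgA.
Qed.

Lemma lamp_mul1 : left_id lamp_one lamp_mul.
Proof.
move=> [e x]; congr (_, _); last exact: mul1g.
apply/fsfunP => w.
by rewrite !(config_addE, config_shiftE, config0E) invg1 mul1g add0r.
Qed.

Lemma lamp_mulr1 : right_id lamp_one lamp_mul.
Proof.
move=> [e x]; congr (_, _); last exact: mulg1.
by apply/fsfunP => w; rewrite !(config_addE, config_shiftE, config0E) addr0.
Qed.

Lemma config_addxx eta : config_add eta eta = config0.
Proof.
apply/fsfunP => w; rewrite config_addE config0E.
by case: (eta w) => [[|[|//]] ?]; exact/val_inj.
Qed.

Lemma lamp_mulV : left_inverse lamp_one lamp_inv lamp_mul.
Proof.
move=> [e x]; congr (_, _); [exact: config_addxx | exact: mulVg].
Qed.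

Lemma lamp_mulrV : right_inverse lamp_one lamp_inv lamp_mul.
Proof.
move=> [e x]; congr (_, _); last exact: mulgV.
rewrite /= -[RHS](config_addxx e); congr config_add.
by apply/fsfunP => w; rewrite !config_shiftE invgK mulVKg.
Qed.

HB.instance Definition _ := isGroup.Build lamplighter
  lamp_mulA lamp_mul1 lamp_mulr1 lamp_mulV lamp_mulrV.

HB.instance Definition _ := isPointed.Build lamplighter 1%g.

(* [lamplighter] is countable when [G] is finitely generated, so the discrete
   sigma-algebra is then generated by the singletons. *)
HB.instance Definition _ := @isMeasurable.Build default_measure_display
  lamplighter discrete_measurable discrete_measurable0
  discrete_measurableC discrete_measurableU.

End Lamplighter.

Section RandomWalk.
Context {d : measure_display} {T : measurableType d} {R : realType}.
Variable P : probability T R.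

Definition mutually_independent (d' : measure_display)
    (T' : measurableType d') (X : nat -> {RV P >-> T'}) :=
  forall (J : {fset nat}) (A : nat -> set T'),
    (forall j, j \in J -> measurable (A j)) ->
    P (\bigcap_(j in [set` J]) (X j @^-1` A j)) =
    (\prod_(j <- J) P (X j @^-1` A j))%E.

Definition iid (d' : measure_display) (T' : measurableType d')
    (X : nat -> {RV P >-> T'}) (mu : probability T' R) :=
  mutually_independent X /\
  forall n (A : set T'), measurable A -> distribution P (X n) A = mu A.

(* [step n] is the (n+1)-st increment. *)
Fixpoint walk (H : groupType) (step : nat -> T -> H) (n : nat) (t : T) : H :=
  if n is m.+1 then (walk step m t * step m t)%g else 1%g.

(* In the next two definitions [X] is a right random walk on [H] started at
   the identity, so that [x * X n] is the same walk started at [x]. *)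
Definition irreducible (H : groupType) (X : nat -> T -> H) :=
  forall x y : H, exists n, (0 < P [set t | (x * X n t)%g = y])%E.

Definition transient (H : groupType) (X : nat -> T -> H) :=
  forall x : H,
    (P [set t | exists2 n, (0 < n)%N & (x * X n t)%g = x] < 1)%E.

End RandomWalk.

(* Main.v *)
Require Import Defs.
From mathcomp Require Import all_boot all_order all_algebra finmap.
From mathcomp Require Import all_classical all_reals all_analysis measurable_realfun.
(** Because [G] is finitely generated, it is countable, and every event about
[Z_0, ..., Z_n] is an event about the word [i_1 ... i_n] of increments, which
takes each value with probability the product of the masses of its letters. Let
[p] be the probability that the base walk never returns to its starting point,
so that the base walk is transient exactly when [p > 0]. Almost surely the
quantities [|supp eta_n| / n] are bounded for [n >= 1], since a step only
changes lamps in a translate of a fixed finite set [B]; by dominated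
convergence the almost sure limit is also the limit of [E|supp eta_n| / n], and
it is enough to bound that expectation on both sides.

Upper bound ([limit_le_escape]). The support of [eta_n] lies almost surely in
the union of the translates [x B] over the visited points [x]. Counting each
visited point at its last visit, the expected number of them is the sum over
[k <= n] of the probabilities that the walk avoids its starting point for [k]
steps. These probabilities decrease to [p], so by Cesaro the limit is at most
[2 |B| p], and a positive limit forces transience.

Lower bound ([limit_ge_escape]). By irreducibility there are two words [a] and
[b] of the same length [L] and of positive weight, both bringing the base walk
back to its start, and such that [b] flips the lamp there whereas [a] does not
([exists_switching_words]). Cut time into blocks of length [L]. Exchanging [a]
and [b] in a block leaves the base trajectory unchanged outside that block and
flips the final state of the lamp at the place where the block is run. So,
whatever the other blocks are, this block is [a] or [b] and leaves this lamp
finally lit with probability at least [c], the smaller of the weights of [a]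
and [b]; since the other blocks alone decide whether the place is visited after
the block, this happens without later visit with probability at least [c p].
Distinct blocks for which it does are run at distinct places, so
[E|supp eta_{mL}| >= m c p], and the limit is at least [c p / L]. *)

Set Implicit Arguments.
Unset Strict Implicit.
Unset Printing Implicit Defensive.
Import Order.TTheory GRing.Theory Num.Theory.
Import numFieldNormedType.Exports.
Local Open Scope classical_set_scope.
Local Open Scope ring_scope.

(** * Countably valued observables *)

Section CountableRange.
Context {d : measure_display} {T : measurableType d} {R : realType} {C : Type}.
Hypothesis C_countable : countable [set: C].

Lemma measurable_preimage_countable (Y : T -> C) (D : set C) :
  (forall c, measurable (Y @^-1` [set c])) -> measurable (Y @^-1` D).
Proof.
move=> mY.
have -> : Y @^-1` D = \bigcup_c (Y @^-1` [set c] `&` [set _ | D c]).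
  by apply/seteqP; split=> [t Dt|t [c _ [/= <-]]//]; exists (Y t).
apply: countable_bigcupT_measurable => // c; apply: measurableI => //.
by have [Dc|nDc] := pselect (D c);
  [rewrite (_ : mkset _ = setT)|rewrite (_ : mkset _ = set0)] => //;
  apply/seteqP; split.
Qed.

(** One enumeration of the range serves all measures, maps and sets, so that
identities between point masses can be summed term by term. Indices that
enumerate no point contribute zero. *)
Lemma enum_point_masses : exists c : nat -> option C,
  forall (m : {measure set T -> \bar R}) (Y : T -> C) (A : set T) (D : set C),
    measurable A -> (forall x, measurable (Y @^-1` [set x])) ->
    m (A `&` Y @^-1` D) =
    (\sum_(0 <= n <oo)
       if c n is Some x then m (A `&` Y @^-1` ([set x] `&` D)) else 0)%E.
Proof.
have /countable_injP[f f_inj] := C_countable.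
exists (fun n => if pselect (exists x, f x = n) is left ex
                 then Some (sval (cid ex)) else None).
move=> m Y A D mA mY.
pose F n := A `&` Y @^-1` ((f @^-1` [set n]) `&` D).
have mF n : measurable (F n).
  by apply: measurableI => //; exact: measurable_preimage_countable.
have -> : A `&` Y @^-1` D = \bigcup_n F n.
  apply/seteqP; split=> [t [At Dt]|t [n _ [At [_ Dt]]]]; last by split.
  by exists (f (Y t)).
rewrite measure_bigcup//; last first.
  by move=> i j _ _ [t [[_ [/= <- _]] [_ [/= <- _]]]].
transitivity (\sum_(0 <= n <oo) m (F n))%E.
  by apply: eq_eseriesl => n; rewrite in_setT.
apply: eq_eseriesr => n _; case: pselect => [ex|nex].
  case: cid => x /= <-; rewrite /F; congr (m (A `&` (Y @^-1` (_ `&` _)))).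
  by apply/seteqP; split => [y/= /f_inj|y /= ->//]; apply; rewrite in_setT.
rewrite (_ : F n = set0) ?measure0//; apply/seteqP; split=> // t [_ [/= ft _]].
by apply: nex; exists (Y t).
Qed.

(** The form in which both stationarity ([q = 1] and [A] the whole space) and
independence ([A] an event of probability [q]) pass from points to sets. *)
Lemma proportional_point_masses (m : {measure set T -> \bar R}) (A : set T)
    (q : R) (Y Y' : T -> C) :
  measurable A -> 0 <= q ->
  (forall x, measurable (Y @^-1` [set x])) ->
  (forall x, measurable (Y' @^-1` [set x])) ->
  (forall x, m (A `&` Y @^-1` [set x]) = q%:E * m (Y' @^-1` [set x]))%E ->
  forall D, (m (A `&` Y @^-1` D) = q%:E * m (Y' @^-1` D))%E.
Proof.
move=> mA q0 mY mY' eqm D; have [c enumE] := enum_point_masses.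
rewrite enumE// -[Y' @^-1` D]setTI enumE// -nneseriesZl; last first.
  by move=> n _; case: (c n) => [x|].
apply: eq_eseriesr => n _; case: (c n) => [x|]; last by rewrite mule0.
have [Dx|nDx] := pselect (D x).
  have -> : [set x] `&` D = [set x] by apply: setIidl => y ->.
  by rewrite setTI eqm.
have -> : [set x] `&` D = set0 by apply/seteqP; split=> // y /= [->].
by rewrite !preimage_set0 !setI0 measure0 mule0.
Qed.

End CountableRange.

Lemma countable_seq (C : Type) : countable [set: C] -> countable [set: seq C].
Proof.
move=> /countable_injP[f f_inj]; apply/countable_injP.
exists (fun w => choice.pickle (map f w)) => w w' _ _.
move=> /(pcan_inj choice.pickleK) /inj_map; apply.
by move=> x y; apply: f_inj; rewrite in_setT.
Qed.

(** * Words of independent letters *)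

Section IidWords.
Context {d : measure_display} {T : measurableType d} {R : realType}.
Context {P : probability T R} {d' : measure_display} {E : measurableType d'}.
Variables (mu : probability E R) (step : nat -> {RV P >-> E}).
Hypothesis E_countable : countable [set: E].
Hypothesis E_discrete : forall A : set E, measurable A.
Hypothesis step_iid : iid step mu.

(** Arbitrary index lists, rather than intervals, let one list gather the times
before and after a block. *)
Definition observe (J : seq nat) (t : T) : seq E := [seq step j t | j <- J].

Definition word_weight (w : seq E) : R := \prod_(z <- w) fine (mu [set z]).

Lemma word_weight_ge0 w : 0 <= word_weight w.
Proof. by apply: prodr_ge0 => z _; rewrite fine_ge0. Qed.

Lemma measurable_observe J (D : set (seq E)) : measurable (observe J @^-1` D).
Proof.
apply: measurable_preimage_countable; first exact: countable_seq.
elim: J => [|j J IH] w.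
  have [->|w0] := eqVneq w [::].
    by rewrite (_ : _ @^-1` _ = setT)//; apply/seteqP; split.
  rewrite (_ : _ @^-1` _ = set0)//; apply/seteqP; split => //= t /= /esym w0'.
  by rewrite w0' in w0.
case: w => [|z w]; first by rewrite (_ : _ @^-1` _ = set0)//; apply/seteqP; split.
rewrite (_ : _ @^-1` _ = (step j @^-1` [set z]) `&` (observe J @^-1` [set w])).
  by apply: measurableI => //; apply: measurable_funPTI.
by apply/seteqP; split=> [t [<- <-]|t [/= <- <-]].
Qed.

Lemma prob_observe J w : uniq J -> size w = size J ->
  P (observe J @^-1` [set w]) = (word_weight w)%:E.
Proof.
move=> uJ sz.
have step1 j z : P (step j @^-1` [set z]) = mu [set z].
  by rewrite -(step_iid.2 j)//.
pose A j : set E := [set nth (step 0 point) w (index j J)].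
have -> : observe J @^-1` [set w] =
    \bigcap_(j in [set` [fset j in J]%fset]) (step j @^-1` A j).
  apply/seteqP; split=> [t /= tw j /=|t tw].
    rewrite !inE => jJ; rewrite /A -tw /= (nth_map 0%N) ?index_mem//.
    by rewrite nth_index.
  apply: (@eq_from_nth _ (step 0 point)); rewrite ?size_map// => i iJ.
  rewrite (nth_map 0%N)//; have := tw (nth 0%N J i).
  by rewrite /A /= index_uniq//; apply; rewrite !inE mem_nth.
rewrite step_iid.1//.
under eq_bigr do rewrite step1.
have -> : (\prod_(j <- [fset j in J]%fset) mu (A j) = \prod_(j <- J) mu (A j))%E.
  apply: perm_big; apply: uniq_perm => //= j.
  by rewrite !inE.
rewrite /word_weight -prodEFin.
have -> : (\prod_(z <- w) (fine (mu [set z]))%:E = \prod_(z <- w) mu [set z])%E.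
  by apply: eq_bigr => z _; rewrite fineK// fin_num_measure.
rewrite (big_nth 0%N) (big_nth (step 0 point)) sz.
by rewrite !big_nat; apply: eq_bigr => i /andP[_ iJ]; rewrite /A index_uniq.
Qed.

Lemma prob_observe_stationary J J' (D : set (seq E)) :
  uniq J -> uniq J' -> size J = size J' ->
  P (observe J @^-1` D) = P (observe J' @^-1` D).
Proof.
move=> uJ uJ' sz; rewrite -[RHS]mul1e -[observe J @^-1` D]setTI.
have masses w : (P (setT `&` observe J @^-1` [set w]) =
                 1%:E * P (observe J' @^-1` [set w]))%E.
  rewrite setTI mul1e; have [szw|szw] := eqVneq (size w) (size J).
    by rewrite !prob_observe// -sz.
  have none K : size K = size J -> observe K @^-1` [set w] = set0.
    move=> szK; apply/seteqP; split=> // t /= tw.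
    by move: szw; rewrite -tw size_map szK eqxx.
  by rewrite !none.
apply: (proportional_point_masses _ _ _ _ _ masses) => //.
- exact: countable_seq.
- by move=> w; exact: measurable_observe.
- by move=> w; exact: measurable_observe.
Qed.

Lemma prob_observe_indep J a J' (D : set (seq E)) :
  uniq (J ++ J') -> size a = size J ->
  (P (observe J @^-1` [set a] `&` observe J' @^-1` D) =
  (word_weight a)%:E * P (observe J' @^-1` D))%E.
Proof.
move=> uJJ' sza; have /and3P[uJ _ uJ'] : [&& uniq J, ~~ has (mem J) J' & uniq J'].
  by rewrite -cat_uniq.
have masses w : (P (observe J @^-1` [set a] `&` observe J' @^-1` [set w]) =
                 (word_weight a)%:E * P (observe J' @^-1` [set w]))%E.
  have [szw|szw] := eqVneq (size w) (size J').
    rewrite (_ : _ `&` _ = observe (J ++ J') @^-1` [set a ++ w]); last first.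
      apply/seteqP; split=> t /=; rewrite /observe map_cat; first by case=> -> ->.
      by move=> /eqP; rewrite eqseq_cat ?size_map// => /andP[/eqP-> /eqP->].
    rewrite !prob_observe// ?size_cat ?sza ?szw//.
    by rewrite /word_weight big_cat EFinM.
  rewrite (_ : observe J' @^-1` [set w] = set0) ?setI0 ?measure0 ?mule0//.
  apply/seteqP; split=> // t /= tw.
  by move: szw; rewrite -tw size_map eqxx.
apply: (proportional_point_masses _ _ _ _ _ masses).
- exact: countable_seq.
- exact: measurable_observe.
- exact: word_weight_ge0.
- by move=> w; exact: measurable_observe.
- by move=> w; exact: measurable_observe.
Qed.

Definition charged (z : E) := (0 < mu [set z])%E.

Lemma word_weight_gt0 w : all charged w -> 0 < word_weight w.
Proof.
move=> /allP w_charged; rewrite /word_weight big_seq.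
apply: prodr_gt0 => z /w_charged z_gt0; apply: fine_gt0; apply/andP; split=> //.
by rewrite ltey_eq fin_num_measure.
Qed.

(** There are only countably many words, and those with a letter of mass zero
have probability zero. *)
Lemma exists_charged_word J (D : set (seq E)) : uniq J ->
  (0 < P (observe J @^-1` D))%E ->
  exists w, [/\ D w, size w = size J & all charged w].
Proof.
move=> uJ; apply: contraPP => none; apply/negP; rewrite -leNgt.
have [c enumE] := enum_point_masses (countable_seq E_countable)
  (T := T) (R := R).
rewrite -[X in P X]setTI enumE//; last by move=> w; exact: measurable_observe.
rewrite eseries0// => n _ _; case: (c n) => // w; rewrite setTI.
have [[Dw szw]|off] := pselect (D w /\ size w = size J); last first.
  rewrite (_ : _ @^-1` _ = set0) ?measure0//; apply/seteqP; split=> // t /= [tw].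
  by move=> Dt; apply: off; rewrite -tw size_map.
apply/eqP; rewrite eq_le measure_ge0 andbT.
apply: (@le_trans _ _ (P (observe J @^-1` [set w]))).
  by apply: le_measure; rewrite ?inE; [exact: measurable_observe..|move=> t []].
rewrite prob_observe// lee_fin leNgt; apply/negP => w_gt0; apply: none.
exists w; split=> //; apply/allP => z zw; rewrite /charged lt0e measure_ge0 andbT.
apply/eqP => z0; move: w_gt0; rewrite /word_weight.
by rewrite (perm_big _ (perm_to_rem zw)) big_cons z0 /= mul0r ltxx.
Qed.

Lemma ae_charged : {ae P, forall t, forall n, charged (step n t)}.
Proof.
apply: ae_foralln => n.
have : P (observe [:: n] @^-1` [set w | ~~ all charged w]) = 0.
  apply/eqP; rewrite eq_le measure_ge0 andbT leNgt; apply/negP.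
  by move=> /exists_charged_word[]// w [/= /negP].
move=> null; apply: (negligibleS _ (proj2 (negligibleP _ _) null)).
  by move=> t /= /negP; rewrite andbT.
exact: measurable_observe.
Qed.

Lemma measurable_fun_observe d1 (V : measurableType d1) J (f : seq E -> V) :
  measurable_fun [set: T] (f \o observe J).
Proof. by move=> _ B mB; rewrite setTI comp_preimage; exact: measurable_observe. Qed.

Lemma integral_count J n (p : 'I_n -> pred (seq E)) :
  (\int[P]_t ((\sum_(k < n) p k (observe J t))%:R%:E) =
   \sum_(k < n) P (observe J @^-1` [set w | p k w]))%E.
Proof.
transitivity (\int[P]_t (\sum_(k < n)
    (\1_(observe J @^-1` [set w | p k w]) t)%:E))%E.
  apply: eq_integral => t _; rewrite natr_sum sumEFin; congr EFin.
  apply: eq_bigr => k _; rewrite indicE.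
  by case: (boolP (p k _)) => pk; [rewrite mem_set|rewrite memNset//; exact/negP].
rewrite ge0_integral_sum//; last first.
  move=> k; apply/measurable_EFinP; apply: measurable_indic.
  exact: measurable_observe.
apply: eq_bigr => k _; rewrite integral_indic ?setIT//.
exact: measurable_observe.
Qed.

End IidWords.

(** * Supports of products of lamplighter elements *)

Section Words.
Variable G : groupType.
Implicit Types (w u v : seq (lamplighter G)) (B : {fset G}).

Definition product w : lamplighter G := (\prod_(z <- w) z)%g.

Lemma product_cat u v : product (u ++ v) = (product u * product v)%g.
Proof. by rewrite /product big_cat. Qed.

Lemma product_cons z w : product (z :: w) = (z * product w)%g.
Proof. by rewrite /product big_cons. Qed.

Lemma product_nil : product [::] = 1%g.
Proof. by rewrite /product big_nil. Qed.

Lemma lampM_base (z1 z2 : lamplighter G) : (z1 * z2)%g.2 = (z1.2 * z2.2)%g.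
Proof. by []. Qed.

Lemma lampM_lamp (z1 z2 : lamplighter G) x :
  (z1 * z2)%g.1 x = z1.1 x + z2.1 (z1.2^-1 * x)%g.
Proof. by rewrite [LHS]config_addE config_shiftE. Qed.

Definition never_returns w :=
  all (fun j => (product (take j w)).2 != 1%g) (iota 1 (size w)).

Lemma never_returnsP w :
  reflect (forall j, (0 < j <= size w)%N -> (product (take j w)).2 != 1%g)
          (never_returns w).
Proof.
apply: (iffP allP) => H j; last by rewrite mem_iota add1n ltnS; exact: H.
by move=> jw; apply: H; rewrite mem_iota add1n ltnS.
Qed.

Fixpoint visited w : {fset G} :=
  if w is z :: w' then (1%g |` [fset (z.2 * x)%g | x in visited w'])%fset
  else [fset 1%g]%fset.

Lemma mem_visited w k : (product (take k w)).2 \in visited w.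
Proof.
elim: w k => [|z w IH] [|k] /=; rewrite ?product_nil ?fset11 ?fset1U1//.
rewrite product_cons in_fsetU; apply/orP; right; apply/imfsetP.
by exists (product (take k w)).2; rewrite ?IH.
Qed.

(** Each visited place is counted at its last visit, that is, at the times from
which the remaining walk never returns. *)
Lemma card_visited_le w :
  (#|` visited w| <= \sum_(k < (size w).+1) never_returns (drop k w))%N.
Proof.
elim: w => [|z w IH]; first by rewrite /= cardfs1 big_ord1.
rewrite [visited _]/= cardfsU1 big_ord_recl; apply: leq_add; last first.
  by apply: leq_trans IH; exact: leq_imfset_card.
rewrite [drop _ _]/=; case: (boolP (_ \in _)) => //= nvis; rewrite lt0b.
apply/never_returnsP => -[//|j] _; apply: contra nvis => /eqP zj.
apply/imfsetP; exists (product (take j w)).2; first exact: mem_visited.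
by rewrite -zj /= product_cons.
Qed.

Lemma finsupp_product_sub B w : all (fun z => finsupp z.1 `<=` B)%fset w ->
  {subset finsupp (product w).1 <= [seq (x * b)%g | x <- visited w, b <- B]}.
Proof.
elim: w => [|z w IH] /=.
  by move=> _ y; rewrite product_nil mem_finsupp config0E eqxx.
move=> /andP[zB /IH wB] y.
rewrite product_cons mem_finsupp lampM_lamp => yz; apply/allpairsP.
have [zy|zy] := eqVneq (z.1 y) 0; last first.
  exists (1%g, y); rewrite /= fset1U1 mul1g; split=> //.
  by apply: (fsubsetP zB); rewrite mem_finsupp.
have : (z.2^-1 * y)%g \in finsupp (product w).1.
  by rewrite mem_finsupp; move: yz; rewrite zy add0r.
move=> /wB /allpairsP[[x b] /= [xw bB zyE]].
exists ((z.2 * x)%g, b); split=> //=; last by rewrite -mulgA -zyE mulVKg.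
by rewrite in_fsetU; apply/orP; right; apply/imfsetP; exists x.
Qed.

(** A lit lamp was changed at some step, hence lies in the translate of [B] by
the place from which that step was made. *)
Lemma card_supp_le B w : all (fun z => finsupp z.1 `<=` B)%fset w ->
  (#|` finsupp (product w).1| <=
     #|` B| * \sum_(k < (size w).+1) never_returns (drop k w))%N.
Proof.
move=> wB; apply: leq_trans (leq_mul (leqnn _) (card_visited_le w)).
rewrite mulnC -(size_allpairs (fun x b => (x * b)%g)).
apply: uniq_leq_size; first exact: fset_uniq.
exact: finsupp_product_sub.
Qed.

Section Switch.
Variables (a b : seq (lamplighter G)) (L : nat).
Hypotheses (base_a : (product a).2 = 1%g) (base_b : (product b).2 = 1%g).

Definition block j w := take L (drop (j * L) w).

Definition position j w := (product (take (j * L) w)).2.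

(** The last condition excludes returns to the place of the block: a block equal
to [a] or [b] ends where it began. *)
Definition switched j w :=
  [&& block j w \in [:: a; b], (product w).1 (position j w) == 1
    & never_returns (drop (j.+1 * L) w)].

Lemma position_next j w : block j w \in [:: a; b] ->
  position j.+1 w = position j w.
Proof.
move=> jab; rewrite /position mulSn addnC takeD product_cat lampM_base -/(block j w).
by move: jab; rewrite !inE => /orP[]/eqP->; rewrite ?base_a ?base_b mulg1.
Qed.

(** Switched blocks are run at distinct places: after the earlier block the walk
never comes back to the place of that block, whereas it stands at the place of
the later block when that block ends. Comparing the ends of the two blocks,
rather than their starts, covers the case of consecutive blocks. *)
Lemma card_supp_ge m w : (0 < L)%N -> size w = (m * L)%N ->
  (\sum_(j < m) switched j w <= #|` finsupp (product w).1|)%N.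
Proof.
move=> L0 sw.
have nosame i j : (i < j < m)%N -> switched i w -> switched j w ->
    position i w != position j w.
  move=> /andP[ij jm] /and3P[iab _ /never_returnsP inr] /and3P[jab _ _].
  rewrite -(position_next iab) -(position_next jab) /position.
  have e : (j.+1 * L = i.+1 * L + (j - i) * L)%N.
    by rewrite -mulnDl addSn subnKC// ltnW.
  rewrite e takeD product_cat lampM_base.
  have := inr ((j - i) * L)%N; rewrite muln_gt0 subn_gt0 ij L0/= size_drop sw.
  rewrite leq_subRL ?leq_mul2r ?(leq_trans ij) ?orbT//; last by rewrite ltnW.
  rewrite -e leq_mul2r jm orbT => /(_ isT); apply: contra => /eqP ij_eq.
  by apply/eqP/(mulgI (product (take (i.+1 * L) w)).2); rewrite mulg1 -ij_eq.
rewrite -(big_mkord xpredT (fun j => nat_of_bool (switched j w))) -big_mkcond.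
rewrite sum1_count -size_filter -(size_map (position^~ w)).
apply: uniq_leq_size => [|y /mapP[j]]; last first.
  rewrite mem_filter => /andP[/and3P[_ /eqP jw _] _] ->.
  by rewrite mem_finsupp jw.
rewrite map_inj_in_uniq ?filter_uniq ?iota_uniq// => i j.
rewrite !mem_filter !mem_index_iota /= => /andP[iw im] /andP[jw jm] /eqP.
have [ij|ji|->//] := ltngtP i j; first by rewrite (negbTE (nosame _ _ _ iw jw)) ?ij.
by rewrite eq_sym (negbTE (nosame _ _ _ jw iw)) ?ji.
Qed.

End Switch.

End Words.

(** * Countability of the group and finiteness of balls *)

Section Geometry.
Variable G : groupType.

Lemma countable_inj (A B : Type) (f : A -> B) :
  injective f -> countable [set: B] -> countable [set: A].
Proof.
move=> f_inj /countable_injP[g g_inj]; apply/countable_injP.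
by exists (g \o f) => x y _ _ /g_inj /f_inj; apply; rewrite in_setT.
Qed.

Lemma generated_word (S : {fset G}) : generates_semigroup [set s | s \in S] ->
  forall x, exists2 w, {subset w <= S} & x = (\prod_(s <- w) s)%g.
Proof.
move=> S_gen x; have : [set: G] x by [].
rewrite -S_gen => /(_ [set x | exists2 w, {subset w <= S} &
  x = (\prod_(s <- w) s)%g]); apply; split=> [y z [u uS ->] [v vS ->]|s sS].
  exists (u ++ v); last by rewrite big_cat.
  by move=> r; rewrite mem_cat => /orP[/uS|/vS].
by exists [:: s]; [move=> r; rewrite inE => /eqP->|rewrite big_seq1].
Qed.

Lemma countable_generated (S : {fset G}) :
  generates_semigroup [set s | s \in S] -> countable [set: G].
Proof.
move=> /generated_word S_word.
apply: (@sub_countable _ _ _ [set (\prod_(s <- w) val s)%g | w in [set: seq S]]).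
  apply: subset_card_le => x _; have [w wS ->] := S_word x.
  exists (pmap insub w) => //.
  rewrite -(big_map val xpredT id) pmap_filter; last exact: insubK.
  by rewrite (all_filterP _)//; apply/allP => s sw; rewrite isSome_insub wS.
exact: sub_countable (card_image_le _ _) _.
Qed.

Lemma config_finsupp_inj : injective (fun eta : config G => finsupp eta).
Proof.
move=> e1 e2 supp_eq; apply/fsfunP => x.
have : (e1 x != 0) = (e2 x != 0) by rewrite -!mem_finsupp supp_eq.
by case: (e1 x) (e2 x) => [[|[|//]] ?] [[|[|//]] ?] //= _; exact: val_inj.
Qed.

(** Lamps have only two states, so a configuration is determined by its
support. *)
Lemma countable_lamplighter :
  countable [set: G] -> countable [set: lamplighter G].
Proof.
move=> /countable_seq; apply: (@countable_inj _ _ (fun z => z.2 :: finsupp z.1)).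
by move=> [e1 x1] [e2 x2] /= [-> /val_inj/config_finsupp_inj ->].
Qed.

Lemma words_finite (S : {fset G}) K : exists B : {fset G}, forall w,
  {subset w <= S} -> (size w <= K)%N -> (\prod_(s <- w) s)%g \in B.
Proof.
elim: K => [|K [B IH]].
  by exists [fset 1%g]%fset => -[|//] _ _; rewrite big_nil fset11.
exists (1%g |` [fset (s * x)%g | s in S, x in B])%fset => -[|s w] wS sw.
  by rewrite big_nil fset1U1.
rewrite big_cons in_fsetU; apply/orP; right; apply/imfset2P; exists s => /=.
  by apply: wS; rewrite mem_head.
exists (\prod_(r <- w) r)%g => //; apply: IH => // r rw.
by apply: wS; rewrite inE rw orbT.
Qed.

Lemma positive_lower_bound (R : realType) (S : {fset G}) (l : G -> R) :
  (forall s, s \in S -> 0 < l s) ->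
  exists2 e, 0 < e & forall s, s \in S -> e <= l s.
Proof.
move=> l_gt0; exists (\big[Num.min/1]_(s <- S) l s) => [|s sS].
  by rewrite big_seq; elim/big_ind: _ => // x y x0 y0; rewrite lt_min x0.
exact: ge_bigmin_seq.
Qed.

(** Edge lengths have a positive lower bound, so a word of bounded length has a
bounded number of letters. *)
Lemma ball_finite (R : realType) (S : {fset G}) (l : G -> R) (r : R) :
  generates_semigroup [set s | s \in S] ->
  (forall s, s \in S -> 0 < l s) ->
  exists B : {fset G}, forall y, dist S l 1%g y <= r -> y \in B.
Proof.
move=> /generated_word S_word l_gt0.
have [e e0 le] := positive_lower_bound l_gt0.
have [K rK] : exists K : nat, (r + 1) / e <= K%:R.
  by exists (Num.truncn ((r + 1) / e)).+1; exact/ltW/truncnS_gt.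
have [B BP] := words_finite S K; exists B => y yr.
have yr1 : dist S l 1%g y < r + 1 by rewrite (le_lt_trans yr)// ltrDl.
have [_ [w [wS ->] <-] lw] : exists2 s, [set \sum_(s <- w) l s |
    w in [set w : seq G | {subset w <= S} /\ y = (1 * \prod_(s <- w) s)%g]] s
    & s < r + 1.
  apply: inf_lt yr1; have [w wS ->] := S_word y.
  by exists (\sum_(s <- w) l s), w => //; split; rewrite ?mul1g.
rewrite mul1g; apply: BP => //; rewrite -(ler_nat R).
apply: le_trans rK; rewrite ler_pdivlMr// (le_trans _ (ltW lw))//.
rewrite big_seq (_ : (size w)%:R * e = \sum_(s <- w | s \in w) e).
  by apply: ler_sum => s /wS; exact: le.
by rewrite -big_seq big_const_seq count_predT iter_addr_0 mulr_natl.
Qed.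

End Geometry.

(** * Expected size of the support *)

Section RandomWalk.
Context {R : realType} {G : groupType}.
Context {d : measure_display} {T : measurableType d} {P : probability T R}.
Variables (mu : probability (lamplighter G) R).
Variable step : nat -> {RV P >-> lamplighter G}.
Hypothesis G_countable : countable [set: G].
Hypothesis step_iid : iid step mu.

Let E_countable := countable_lamplighter G_countable.
Let E_discrete (A : set (lamplighter G)) : measurable A. Proof. by []. Qed.
Let m_observe := measurable_observe step E_countable E_discrete.

Lemma walk_product n t : walk step n t = product (observe step (iota 0 n) t).
Proof.
elim: n => [|n IH]; first by rewrite product_nil.
rewrite -[in RHS]addn1 iotaD add0n /observe map_cat product_cat [LHS]/= IH.
by rewrite [product [seq _ | _ <- iota n 1]]product_cons product_nil mulg1.
Qed.

Definition escape :=
  [set t | forall n, never_returns (observe step (iota 0 n) t)].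

Definition avoidance n :=
  fine (P (observe step (iota 0 n) @^-1` [set w | never_returns w])).

(** The steps are independent and identically distributed, so the starting time
is irrelevant. *)
Lemma avoidanceE k n :
  P (observe step (iota k n) @^-1` [set w | never_returns w]) =
  (avoidance n)%:E.
Proof.
rewrite /avoidance fineK ?fin_num_measure//.
by apply: (prob_observe_stationary E_countable E_discrete step_iid);
  rewrite ?iota_uniq ?size_iota.
Qed.

Lemma avoidance_ge0 n : 0 <= avoidance n.
Proof. by rewrite /avoidance fine_ge0. Qed.

Lemma escapeE : escape =
  \bigcap_n (observe step (iota 0 n) @^-1` [set w | never_returns w]).
Proof. by apply/seteqP; split=> [t te n _|t te n]; exact: te. Qed.

Lemma measurable_escape : measurable escape.
Proof.
by rewrite escapeE; apply: bigcapT_measurable => n; exact: m_observe.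
Qed.

Lemma avoidance_cvg : avoidance @ \oo --> fine (P escape).
Proof.
apply: fine_cvg; rewrite fineK ?fin_num_measure//; last exact: measurable_escape.
rewrite escapeE; apply: nonincreasing_cvg_mu.
- by rewrite ltey_eq fin_num_measure.
- by move=> n; exact: m_observe.
- by rewrite -escapeE; exact: measurable_escape.
move=> m n mn; apply/subsetPset => t /= /never_returnsP nr.
apply/never_returnsP => j; rewrite size_map size_iota => /andP[j0 jm].
have := nr j; rewrite size_map size_iota j0 (leq_trans jm mn) => /(_ isT).
by rewrite /observe -!map_take !take_iota (minn_idPl jm)
  (minn_idPl (leq_trans jm mn)).
Qed.

(** By homogeneity, the return probability is the same from all points. *)
Lemma transient_escape :
  transient P (fun n t => (walk step n t).2) <-> (0 < P escape)%E.
Proof.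
have retE x : P [set t | exists2 n, (0 < n)%N & (x * (walk step n t).2)%g = x] =
    (1 - P escape)%E.
  rewrite -probability_setC; last exact: measurable_escape.
  congr (P _); apply/seteqP; split=> [t [n n0 xn] /= /(_ n)|t /= /existsNP[n]].
    move=> /never_returnsP/(_ n); rewrite size_map size_iota n0 leqnn.
    move=> /(_ isT); rewrite take_oversize ?size_map ?size_iota//.
    by rewrite -walk_product => /eqP; apply; apply: (mulgI x); rewrite mulg1.
  move=> /negP/allPn[j]; rewrite mem_iota size_map size_iota add1n ltnS => /andP[j0 jn].
  move=> /negPn/eqP ret; exists j => //; rewrite walk_product -[RHS]mulg1 -ret.
  by rewrite /observe -map_take take_iota (minn_idPl jn).
have Pe : P escape \is a fin_num by rewrite fin_num_measure//; exact: measurable_escape.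
have lt1 : (1 - P escape < 1)%E = (0 < P escape)%E.
  by rewrite -(fineK Pe) -EFinB !lte_fin ltrBlDr ltrDl.
by split=> [/(_ 1%g)|pos x]; rewrite retE lt1.
Qed.

Section Bounds.
Variable B : {fset G}.
Hypothesis supp_B : forall z, (0 < mu [set z])%E -> (finsupp z.1 `<=` B)%fset.

Definition supp_size n t := #|` finsupp (walk step n t).1|.

Lemma measurable_supp_size (f : nat -> R) n :
  measurable_fun [set: T] (fun t => f (supp_size n t)).
Proof.
rewrite (_ : (fun t => _) =
  (fun w => f #|` finsupp (product w).1|) \o observe step (iota 0 n)).
  exact: measurable_fun_observe.
by apply/funext => t; rewrite /supp_size walk_product.
Qed.

Lemma ae_supp_size_le : {ae P, forall t, forall n,
  (supp_size n t <= #|` B| * \sum_(k < n.+1)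
     never_returns (drop k (observe step (iota 0 n) t)))%N}.
Proof.
apply: filterS (ae_charged E_countable E_discrete step_iid) => t t_charged n.
rewrite /supp_size walk_product.
have := @card_supp_le G B (observe step (iota 0 n) t).
rewrite size_map size_iota; apply; apply/allP => z /mapP[j _ ->].
exact/supp_B/t_charged.
Qed.

Lemma expected_supp_le n :
  (\int[P]_t ((supp_size n t)%:R)%:E <=
   (#|` B|%:R * \sum_(k < n.+1) avoidance k)%:E)%E.
Proof.
pose cnt t := (\sum_(k < n.+1)
     never_returns (drop k (observe step (iota 0 n) t)))%N.
have cntE : (\int[P]_t (cnt t)%:R%:E = (\sum_(k < n.+1) avoidance k)%:E)%E.
  rewrite (integral_count step E_countable E_discrete (iota 0 n)
     (fun k w => never_returns (drop k w))).
  (* the suffix starting at time n - k has k letters *)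
  rewrite (reindex_inj rev_ord_inj) /= -sumEFin; apply: eq_bigr => k _.
  rewrite -(avoidanceE (n - k) k); congr (P _); apply/seteqP.
  have dropE t : drop (n.+1 - k.+1) (observe step (iota 0 n) t) =
      observe step (iota (n - k) k) t.
    rewrite subSS /observe -map_drop drop_iota add0n subKn//.
    by rewrite -ltnS.
  by split=> t /=; rewrite dropE.
rewrite EFinM -cntE -ge0_integralZl//.
- apply: ae_ge0_le_integral => //.
  + by apply/measurable_EFinP; exact: (measurable_supp_size (fun k => k%:R)).
  + exact: (measurable_fun_observe step E_countable E_discrete (iota 0 n)
      (fun w => ((#|` B|%:R : R)%:E *
         (\sum_(k < n.+1) never_returns (drop k w))%:R%:E)%E)).
  apply: filterS ae_supp_size_le => t /(_ n) le _.
  by rewrite -EFinM lee_fin -natrM ler_nat.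
- exact: (measurable_fun_observe step E_countable E_discrete (iota 0 n)
    (fun w => (\sum_(k < n.+1) never_returns (drop k w))%:R%:E : \bar R)).
Qed.

Definition expected_supp n : R := fine (\int[P]_t ((supp_size n t)%:R)%:E).

Lemma expected_suppE n :
  (\int[P]_t ((supp_size n t)%:R)%:E = (expected_supp n)%:E)%E.
Proof.
rewrite fineK// ge0_fin_numE; last exact: integral_ge0.
by rewrite (le_lt_trans (expected_supp_le n))// ltry.
Qed.

(** At time [n >= 1] the support is almost surely covered by [n + 1 <= 2 n]
translates of [B], so dominated convergence applies with the bound [2 |B|]. *)
Lemma expected_supp_cvg (ell : R) :
  {ae P, forall t, (supp_size n t)%:R / n%:R @[n --> \oo] --> ell} ->
  (fun n => expected_supp n / n%:R) @ \oo --> ell.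
Proof.
move=> supp_cvg.
have meanE n : expected_supp n / n%:R =
    fine (\int[P]_t ((supp_size n t)%:R / n%:R)%:E).
  transitivity (fine ((\int[P]_t ((supp_size n t)%:R)%:E) * (n%:R^-1)%:E)%E).
    by rewrite expected_suppE -EFinM.
  rewrite -ge0_integralZr//; apply/measurable_EFinP.
  exact: (measurable_supp_size (fun k => k%:R)).
rewrite (_ : (fun n => _) = fine \o
    (fun n => \int[P]_t ((supp_size n t)%:R / n%:R)%:E)%E); last exact/funext.
apply: fine_cvg.
have -> : ell%:E = (\int[P]_t (cst ell%:E) t)%E.
  transitivity (ell%:E * P setT)%E; first by rewrite probability_setT mule1.
  by rewrite integral_cst.
have [] // := @dominated_convergence _ _ _ P setT measurableT
  (fun n t => ((supp_size n t)%:R / n%:R)%:E) (cst ell%:E)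
  (cst (2 * #|` B|%:R)%:E).
- move=> n; apply/measurable_EFinP.
  exact: (measurable_supp_size (fun k => k%:R / n%:R)).
- apply: filterS supp_cvg => t cvg_t _.
  by apply: cvg_EFin => //; exact: nearW.
- exact: finite_measure_integrable_cst.
apply: filterS ae_supp_size_le => t le n _.
rewrite lee_fin ger0_norm ?divr_ge0//.
have [->|n0] := eqVneq n 0%N; first by rewrite invr0 mulr0 mulr_ge0.
rewrite ler_pdivrMr ?ltr0n ?lt0n// -!natrM ler_nat (leq_trans (le n))//.
rewrite (mulnC 2) -mulnA leq_mul2l; apply/orP; right.
apply: (@leq_trans (\sum_(k < n.+1) 1)%N).
  by apply: leq_sum => k _; exact: leq_b1.
by rewrite sum_nat_const card_ord muln1 mul2n -addnn -addn1 leq_add2l lt0n.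
Qed.

(** The factor 2 comes from comparing the [n + 1] terms of the Cesaro mean with
[n], through [n + 1 <= 2 n]. *)
Lemma limit_le_escape (ell : R) :
  {ae P, forall t, (supp_size n t)%:R / n%:R @[n --> \oo] --> ell} ->
  ell <= 2 * #|` B|%:R * fine (P escape).
Proof.
move=> /expected_supp_cvg mean_cvg.
have cesaro_cvg : (fun n => 2 * #|` B|%:R * arithmetic_mean avoidance n) @ \oo -->
    2 * #|` B|%:R * fine (P escape).
  by apply: cvgMl_tmp; apply: cesaro; exact: avoidance_cvg.
apply: (ler_cvg_to mean_cvg cesaro_cvg); near=> n.
have n0 : (0 < n)%N by near: n; exists 1%N.
rewrite ler_pdivrMr ?ltr0n//.
have := expected_supp_le n; rewrite expected_suppE lee_fin => /le_trans; apply.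
rewrite (mulrC 2) -!mulrA ler_wpM2l// /arithmetic_mean /series/= big_mkord.
set a := \sum_(k < _) _.
have a0 : 0 <= a by apply: sumr_ge0 => k _; exact: avoidance_ge0.
rewrite (mulrC a) 2!mulrA -[leLHS]mul1r ler_wpM2r// mulrAC.
by rewrite ler_pdivlMr ?ltr0n// mul1r -natrM ler_nat mul2n -addnn -addn1 leq_add2l.
Unshelve. all: by end_near. Qed.

Section Lower.
Variables (a b : seq (lamplighter G)) (L : nat).
Hypotheses (size_a : size a = L) (size_b : size b = L) (L_gt0 : (0 < L)%N).
Hypotheses (base_a : (product a).2 = 1%g) (base_b : (product b).2 = 1%g).
Hypotheses (lamp_a : (product a).1 1%g = 0) (lamp_b : (product b).1 1%g = 1).

Let c := Num.min (word_weight mu a) (word_weight mu b).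

(** Condition on all the letters outside the block. If the lamp at the place of
the block would be lit without the block, run [a]; otherwise run [b]. Either
choice has probability at least [c], and neither affects whether the base walk
later comes back to that place. *)
Lemma prob_switched m j : (j < m)%N ->
  ((c * fine (P escape))%:E <=
   P (observe step (iota 0 (m * L)) @^-1` [set w | switched a b L j w]))%E.
Proof.
move=> jm.
pose n := (m * L - j.+1 * L)%N.
pose I := iota (j * L) L; pose U := iota 0 (j * L); pose V := iota (j.+1 * L) n.
have split_iota : iota 0 (m * L) = U ++ I ++ V.
  have -> : (m * L = j * L + (L + n))%N.
    by rewrite addnA -mulSnr /n subnKC// leq_mul2r jm orbT.
  by rewrite !iotaD add0n -mulSnr.
have obs_split t : observe step (iota 0 (m * L)) t =
    observe step U t ++ observe step I t ++ observe step V t.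
  by rewrite split_iota /observe !map_cat.
have size_obs J t : size (observe step J t) = size J by rewrite size_map.
have uniqs : uniq (I ++ (U ++ V)).
  have : uniq (U ++ I ++ V) by rewrite -split_iota iota_uniq.
  by rewrite uniq_catCA.
(* state that the lamp at the place of the block would have without the block,
   read off the prefix followed by the suffix *)
pose lamp (w : seq (lamplighter G)) := let u := take (j * L) w in
  (product u).1 (product u).2 + (product (drop (j * L) w)).1 1%g.
pose D (s : 'Z_2) := [set w | lamp w = s /\ never_returns (drop (j * L) w)].
have obsUV t : (take (j * L) (observe step (U ++ V) t) = observe step U t) *
    (drop (j * L) (observe step (U ++ V) t) = observe step V t).
  have sU : (j * L)%N = size (observe step U t) by rewrite size_obs size_iota.
  by rewrite /observe map_cat -!/(observe _ _ _) sU take_size_cat// drop_size_cat.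
have sub s x : x \in [:: a; b] -> (product x).2 = 1%g ->
    (product x).1 1%g + s = 1 ->
    observe step I @^-1` [set x] `&` observe step (U ++ V) @^-1` D s `<=`
    observe step (iota 0 (m * L)) @^-1` [set w | switched a b L j w].
  move=> xab base_x lamp_x t [/= It]; rewrite /D /= /lamp !obsUV => -[lampUV nrV].
  rewrite obs_split.
  have sU : size (observe step U t) = (j * L)%N by rewrite size_obs size_iota.
  have sI : size (observe step I t) = L by rewrite size_obs size_iota.
  apply/and3P; split.
  - by rewrite /block drop_size_cat// take_size_cat// It.
  - rewrite /position take_size_cat// !product_cat lampM_lamp mulVg.
    by rewrite lampM_lamp It base_x invg1 mulg1 addrCA lampUV lamp_x.
  - by rewrite catA drop_size_cat// size_cat sU sI mulSnr.
have mD s : measurable (observe step (U ++ V) @^-1` D s) by exact: m_observe.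
have ab : a <> b by move=> ab; move: lamp_b; rewrite -ab lamp_a.
have c_ge0 : 0 <= c by rewrite le_min !word_weight_ge0.
apply: (@le_trans _ _ (P
  ((observe step I @^-1` [set a] `&` observe step (U ++ V) @^-1` D 1) `|`
   (observe step I @^-1` [set b] `&` observe step (U ++ V) @^-1` D 0)))); last first.
  apply: le_measure; rewrite ?inE.
  - by apply: measurableU; apply: measurableI => //; exact: m_observe.
  - exact: m_observe.
  - by rewrite subUset; split; apply: sub; rewrite ?inE ?eqxx ?orbT//
      ?lamp_a ?lamp_b ?add0r ?addr0.
have addP A A' : measurable A -> measurable A' -> A `&` A' = set0 ->
    P (A `|` A') = (P A + P A')%E by exact: measureU.
rewrite addP; last 3 first.
- by apply: measurableI => //; exact: m_observe.
- by apply: measurableI => //; exact: m_observe.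
- by apply/seteqP; split=> // t [[/= -> _] [/= /ab]].
rewrite !(prob_observe_indep E_countable E_discrete step_iid) ?size_iota//.
set D1 := _ @^-1` D 1; set D0 := _ @^-1` D 0.
apply: (@le_trans _ _ (c%:E * (P D1 + P D0))%E); last first.
  rewrite ge0_muleDr//; apply: leeD; apply: lee_wpmul2r => //;
    by rewrite lee_fin /c ge_min lexx ?orbT.
have mD1 : measurable D1 by exact: mD.
have mD0 : measurable D0 by exact: mD.
rewrite -addP//; last first.
  by apply/seteqP; split=> // t [[/= l1 _] [/= l0 _]]; rewrite l0 in l1.
rewrite EFinM; apply: lee_wpmul2l; first by rewrite lee_fin.
rewrite fineK ?fin_num_measure//; last exact: measurable_escape.
apply: (@le_trans _ _ (avoidance n)%:E).
  rewrite -(avoidanceE 0); apply: le_measure; rewrite ?inE.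
  - exact: measurable_escape.
  - exact: m_observe.
  - by move=> t; exact.
rewrite -(avoidanceE (j.+1 * L)); apply: le_measure; rewrite ?inE.
- exact: m_observe.
- exact: measurableU.
move=> t /= nr; have [l1|l0] := eqVneq (lamp (observe step (U ++ V) t)) 1.
  by left; split; rewrite ?obsUV.
right; split; rewrite ?obsUV//; move: l0.
by case: (lamp _) => -[|[|//]] ? //= _; exact: val_inj.
Qed.

Lemma expected_supp_ge m :
  m%:R * (c * fine (P escape)) <= expected_supp (m * L).
Proof.
rewrite -lee_fin -expected_suppE.
apply: (@le_trans _ _ (\int[P]_t ((\sum_(j < m)
    switched a b L j (observe step (iota 0 (m * L)) t))%:R)%:E)%E).
  rewrite (integral_count step E_countable E_discrete (iota 0 (m * L))
    (fun j w => switched a b L j w)).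
  apply: (@le_trans _ _ (\sum_(j < m) (c * fine (P escape))%:E)%E).
    by rewrite sumEFin sumr_const card_ord mulr_natl.
  by apply: lee_sum => j _; exact: prob_switched.
apply: ge0_le_integral => //.
- exact: (measurable_fun_observe step E_countable E_discrete (iota 0 (m * L))
    (fun w => (\sum_(j < m) switched a b L j w)%:R%:E : \bar R)).
- by apply/measurable_EFinP; exact: (measurable_supp_size (fun k => k%:R)).
move=> t _; rewrite lee_fin ler_nat /supp_size walk_product.
by apply: card_supp_ge; rewrite ?size_map ?size_iota.
Qed.

Lemma limit_ge_escape (ell : R) :
  {ae P, forall t, (supp_size n t)%:R / n%:R @[n --> \oo] --> ell} ->
  c * fine (P escape) / L%:R <= ell.
Proof.
move=> /expected_supp_cvg mean_cvg.
rewrite leNgt; apply/negP => /(cvgr_lt _ mean_cvg) [N _ /(_ (N.+1 * L)%N)] /=.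
have -> : (N <= N.+1 * L)%N.
  by rewrite (leq_trans (leqnSn N))// leq_pmulr.
move=> /(_ isT); apply/negP; rewrite -leNgt.
rewrite ler_pdivlMr ?ltr0n ?muln_gt0//.
apply: le_trans (expected_supp_ge N.+1).
by rewrite natrM (mulrC N.+1%:R) [leLHS]mulrA divfK ?pnatr_eq0 -?lt0n// mulrC.
Qed.

End Lower.
End Bounds.

Lemma irreducible_charged_word : irreducible P (walk step) ->
  forall y, exists2 w, all (charged mu) w & product w = y.
Proof.
move=> irr y; have [n] := irr 1%g y.
have -> : [set t | (1 * walk step n t)%g = y] =
    observe step (iota 0 n) @^-1` [set w | product w = y].
  by apply/seteqP; split=> t /=; rewrite mul1g walk_product.
move=> /(exists_charged_word E_countable E_discrete step_iid (iota_uniq _ _)).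
by move=> [w [wy _ w_charged]]; exists w.
Qed.

(** Let [h] be a word that switches the lamp at the identity and stays there,
and let [u], [v] be words that only move, by [g <> 1] and back. Then [h h u v]
switches this lamp twice, while [h u h v] switches it once and the lamp at [g]
once. Using the same letters in both words makes the lengths agree, whatever
the parity constraints of the walk are. *)
Lemma exists_switching_words : infinite_set [set: G] ->
  irreducible P (walk step) ->
  exists a b : seq (lamplighter G),
    [/\ size a = size b, (0 < size a)%N, all (charged mu) (a ++ b),
        (product a).2 = 1%g /\ (product b).2 = 1%g &
        (product a).1 1%g = 0 /\ (product b).1 1%g = 1].
Proof.
move=> G_infinite /irreducible_charged_word word.
have [g g1] : exists g : G, g != 1%g.
  apply: contrapT => all1; apply: G_infinite.
  rewrite (_ : [set: G] = [set 1%g]); first exact: finite_set1.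
  apply/seteqP; split=> // x _; apply: contrapT => x1; apply: all1.
  by exists x; exact/eqP.
pose lamp : config G := [fsfun x in [fset 1%g]%fset => (1 : 'Z_2)].
have lampE x : lamp x = (x == 1%g)%:R by rewrite fsfunE inE; case: eqP.
have [h h_charged hE] := word (lamp, 1%g).
have [u u_charged uE] := word (config0 G, g).
have [v v_charged vE] := word (config0 G, g^-1%g).
exists (h ++ h ++ u ++ v), (h ++ u ++ h ++ v); split.
- by rewrite !size_cat; congr (_ + _)%N; rewrite addnCA.
- rewrite size_cat addn_gt0; case: h hE {h_charged} => // /(congr1 fst).
  move=> /(congr1 (fun e : config G => e 1%g)) /=.
  by rewrite product_nil lampE eqxx config0E.
- by rewrite !all_cat h_charged u_charged v_charged.
- by rewrite !product_cat hE uE vE !lampM_base /= !mul1g mulgV.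
rewrite !product_cat hE uE vE !lampM_lamp /= !config0E.
rewrite !lampE !invg1 !mul1g !mulg1 eqxx invg_eq1 (negbTE g1).
by split=> //; exact: val_inj.
Qed.

End RandomWalk.

Theorem theorem3p4 (R : realType) (G : groupType) (S : {fset G}) (l : G -> R)
    (G_infinite : infinite_set [set: G])
    (S_not1 : 1%g \notin S)
    (S_sym : forall s, s \in S -> (s^-1)%g \in S)
    (S_gen : generates_semigroup [set s | s \in S])
    (l_sym : forall s, s \in S -> l s = l (s^-1)%g)
    (l_gt0 : forall s, s \in S -> 0 < l s)
    (d : measure_display) (T : measurableType d) (P : probability T R)
    (mu : probability (lamplighter G) R)
    (step : nat -> {RV P >-> lamplighter G})
    (step_iid : iid step mu)
    (Z := walk step : nat -> T -> lamplighter G)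
    (eta := fun n t => (Z n t).1 : config G)
    (X := fun n t => (Z n t).2 : G)
    (Z_irreducible : irreducible P Z)
    (Z_transient : transient P Z)
    (supp_gen : generates_group [set z | (0 < mu [set z])%E])
    (lamps_bounded : exists2 r : R, 0 <= r &
       forall z : lamplighter G, (0 < mu [set z])%E ->
       forall y, y \in finsupp z.1 -> dist S l 1%g y <= r)
    (first_moment :
       (\esum_(z in [set: lamplighter G])
          ((dist S l 1%g z.2)%:E * mu [set z]) < +oo)%E)
    (ell_supp : R)
    (ell_suppE : {ae P, forall t,
       #|` finsupp (eta n t)|%:R / n%:R @[n --> \oo] --> ell_supp}) :
  0 < ell_supp <-> transient P X.
Proof.
have G_countable := countable_generated S_gen.
have [B supp_B] : exists B : {fset G}, forall z, (0 < mu [set z])%E ->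
    (finsupp z.1 `<=` B)%fset.
  have [r _ lamps_r] := lamps_bounded.
  have [B ballB] := ball_finite r S_gen l_gt0.
  by exists B => z z_gt0; apply/fsubsetP => y yz; exact/ballB/(lamps_r z).
have escape_fin : P (escape step) \is a fin_num.
  by rewrite fin_num_measure//; exact: measurable_escape.
rewrite (transient_escape step G_countable); split=> [ell_gt0|].
  have := limit_le_escape G_countable step_iid supp_B ell_suppE.
  move=> /(lt_le_trans ell_gt0); rewrite -{2}(fineK escape_fin) lte_fin.
  by apply: contraTT; rewrite -!leNgt => /mulr_ge0_le0; apply.
rewrite -{1}(fineK escape_fin) lte_fin => escape_gt0.
have [a [b [size_ab a_gt0 charged_ab [base_a base_b] [lamp_a lamp_b]]]] :=
  exists_switching_words G_countable step_iid G_infinite Z_irreducible.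
have := limit_ge_escape G_countable step_iid supp_B erefl (esym size_ab) a_gt0
  base_a base_b lamp_a lamp_b ell_suppE.
apply: lt_le_trans; move: charged_ab; rewrite all_cat => /andP[ca cb].
by rewrite divr_gt0 ?ltr0n// mulr_gt0// lt_min !word_weight_gt0.
Qed.
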